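(* For every $n\ge0$ there exists a bijection between staircase tableaux of size $n$ containing no $\delta$ and perfect matchings of $\{1,\dots,2n+2\}$ such that a tableau in which exactly $j$ empty boxes are assigned $q$, exactly $k$ boxes contain $\alpha$ and exactly $\ell$ boxes contain $\gamma$ is sent to a matching whose total number of f-crossings (summed over all edges) is $j$, which has exactly $k$ nested edges, and exactly $\ell$ crossed edges.
   Context: A staircase tableau of size $n$ is a filling of the Young diagram of staircase shape $(n,n-1,\dots,1)$ (English convention: row $r$ consists of columns $1,\dots,n+1-r$; the diagonal boxes are the last boxes of the rows) in which each box is empty or labeled by one of $\alpha,\beta,\gamma,\delta$, such that: no diagonal box is empty; every box in the same row and to the left of a $\beta$ or a $\delta$ is empty; every box in the same column and above an $\alpha$ or a $\gamma$ is empty. Each empty box is assigned $q$ or $1$ according to the nearest labeled box to its right in its row and the nearest labeled box below it in its column: it gets $1$ if it sees a $\beta$ to its right; $q$ if it sees a $\delta$ to its right; $1$ if it sees an $\alpha$ or $\gamma$ to its right and an $\alpha$ or $\delta$ below it; $q$ if it sees an $\alpha$ or $\gamma$ to its right and a $\beta$ or $\gamma$ below it. A perfect matching of $\{1,\dots,2n+2\}$ is a set of $n+1$ pairwise disjoint edges $(i,j)$ with $1\le i<j\le 2n+2$. For an edge $e=(i,j)$, $\mathrm{cross}(e)$ is the number of edges $(l,k)$ with $i<l<j<k$, and $\mathrm{nest}(e)$ is the number of edges $(l,k)$ with $l<i<j<k$. The f-crossing of $e$ is $\mathrm{cross}(e)$ if $\mathrm{nest}(e)>0$, and $\lfloor \mathrm{cross}(e)/2\rfloor$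 otherwise. An edge is nested if $\mathrm{cross}(e)<\mathrm{nest}(e)$ and crossed if $\mathrm{cross}(e)>\mathrm{nest}(e)$. *)

(* Defs.v *)
From HB Require Import structures.
From mathcomp Require Import all_boot.

Set Implicit Arguments.
Unset Strict Implicit.
Unset Printing Implicit Defensive.

Inductive label : Type := Alpha | Beta | Gamma | Delta.

Definition label_code (x : label) : bool * bool :=
  match x with
  | Alpha => (false, false)
  | Beta => (false, true)
  | Gamma => (true, false)
  | Delta => (true, true)
  end.

Definition label_decode (c : bool * bool) : label :=
  match c with
  | (false, false) => Alpha
  | (false, true) => Beta
  | (true, false) => Gamma
  | (true, true) => Delta
  end.

Lemma label_codeK : cancel label_code label_decode.
Proof. by case. Qed.

HB.instance Definition _ := Finite.copy label (can_type label_codeK).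

(* Rows and columns are numbered from 0: row r has the columns 0, ..., n-1-r,
   and the boxes with r + c = n-1 are the diagonal ones. *)
Definition box (n : nat) := {p : 'I_n * 'I_n | p.1 + p.2 < n}.

Definition brow n (b : box n) : nat := (val b).1.
Definition bcol n (b : box n) : nat := (val b).2.
Definition diagonal n (b : box n) : bool := (brow b + bcol b).+1 == n.

(* [None] is the empty box. *)
Definition filling (n : nat) := {ffun box n -> option label}.

Definition right_of n (b c : box n) : bool :=
  (brow c == brow b) && (bcol b < bcol c).
Definition below n (b c : box n) : bool :=
  (bcol c == bcol b) && (brow b < brow c).

Definition is_staircase_tableau n (T : filling n) : bool :=
  [&& [forall b : box n, diagonal b ==> (T b != None)],
      [forall b : box n, forall c : box n,
         right_of b c && (T c \in [:: Some Beta; Some Delta])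
           ==> (T b == None)]
    & [forall b : box n, forall c : box n,
         below b c && (T c \in [:: Some Alpha; Some Gamma])
           ==> (T b == None)]].

Definition delta_free n (T : filling n) : bool :=
  [forall b : box n, T b != Some Delta].

Definition delta_free_tableau (n : nat) :=
  {T : filling n | is_staircase_tableau T && delta_free T}.

(* "Sees" refers to the nearest labeled box in the given direction. *)
Definition sees_right n (T : filling n) (b : box n) (x : label) : bool :=
  [exists c : box n,
    [&& right_of b c, T c == Some x
      & [forall d : box n, right_of b d && right_of d c ==> (T d == None)]]].

Definition sees_below n (T : filling n) (b : box n) (x : label) : bool :=
  [exists c : box n,
    [&& below b c, T c == Some x
      & [forall d : box n, below b d && below d c ==> (T d == None)]]].

Definition assigned_q n (T : filling n) (b : box n) : bool :=
  (T b == None) &&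
  (sees_right T b Delta ||
   (sees_right T b Alpha || sees_right T b Gamma) &&
   (sees_below T b Beta || sees_below T b Gamma)).

Definition num_q n (T : filling n) : nat := #|[set b : box n | assigned_q T b]|.
Definition num_label n (T : filling n) (x : label) : nat :=
  #|[set b : box n | T b == Some x]|.

(* The points 1, ..., m are represented by 0, ..., m-1; a matching is its set
   of edges (i, j) with i < j. *)
Definition edge (m : nat) := ('I_m * 'I_m)%type.

Definition disjoint_edges m (e f : edge m) : bool :=
  [&& e.1 != f.1, e.1 != f.2, e.2 != f.1 & e.2 != f.2].

Definition is_perfect_matching n (M : {set edge (2 * n + 2)}) : bool :=
  [&& #|M| == n.+1,
      [forall e in M, e.1 < e.2]
    & [forall e in M, forall f in M, (e != f) ==> disjoint_edges e f]].

Definition perfect_matching (n : nat) :=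
  {M : {set edge (2 * n + 2)} | is_perfect_matching M}.

Definition cross m (M : {set edge m}) (e : edge m) : nat :=
  #|[set f in M | [&& e.1 < f.1, f.1 < e.2 & e.2 < f.2]]|.

Definition nest m (M : {set edge m}) (e : edge m) : nat :=
  #|[set f in M | [&& f.1 < e.1, e.1 < e.2 & e.2 < f.2]]|.

Definition f_crossing m (M : {set edge m}) (e : edge m) : nat :=
  if 0 < nest M e then cross M e else (cross M e)./2.

Definition total_f_crossing m (M : {set edge m}) : nat :=
  \sum_(e in M) f_crossing M e.

Definition num_nested m (M : {set edge m}) : nat :=
  #|[set e in M | cross M e < nest M e]|.
Definition num_crossed m (M : {set edge m}) : nat :=
  #|[set e in M | nest M e < cross M e]|.

(* Main.v *)
Require Import Defs.
From mathcomp Require Import all_boot all_order all_algebra ring zify.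

(* Both sides have the same generating polynomial in [q] (empty boxes assigned
   q, or f-crossings), [x] (Alpha, or nested edges) and [y] (Gamma, or crossed
   edges); a statistics-preserving bijection then exists by counting fibres.

   Reading a matching from left to right turns it into a Dyck path in which a
   down step from height h has weight w_h, the sum over the possible openers of
   the edge being closed: w_(2k) = [k](x + y q^(k-1)) and
   w_(2k+1) = q^k + [k](x + y q^k), where [k] = 1 + q + ... + q^(k-1).

   A tableau is built by adding columns on the left; only the number r of rows
   without a Beta matters for the next column. On polynomials in X, where X^r
   stands for r such rows, adding a column is a linear operator M with
   (1 - (1-q)X) M p
     = ((1 - (1-q)X)(1 + yX) + xX) p(1 + qX) - x(1-q) X^2 p.
   With Q_k the product of (x + y q^i)(X - [i+1]) over i < k, one finds
   M Q_k = Q_(k+1) + (w_(2k+1) + w_(2k+2)) Q_k + w_(2k) w_(2k+1) Q_(k-1),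
   which is the effect of two steps of the Dyck path, and Q_k(1) = 0 for
   k > 0, so M^n 1 at X = 1 is the weight of the Dyck paths of length
   2n + 2. *)

Set Implicit Arguments.
Unset Strict Implicit.
Unset Printing Implicit Defensive.
Import GRing.Theory.
Local Open Scope ring_scope.

(** * Dyck path weights *)

Section Weights.
Variables (R : comNzRingType) (q x y : R).

Definition qnat (k : nat) : R := \sum_(0 <= i < k) q ^+ i.

Definition edge_weight (c p : nat) : R :=
  q ^+ (if (0 < p)%N then c else c./2) * x ^+ (c < p)%N * y ^+ (p < c)%N.

Definition close_weight (h : nat) : R :=
  \sum_(0 <= p < h) edge_weight (h.-1 - p) p.

(** Weighted count of the paths with [m] steps from height [h] to height 0. The truncated [h.-1] at
    [h = 0] is harmless, since [close_weight 0 = 0]. *)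
Fixpoint dyck_weight (m h : nat) : R :=
  if m is m'.+1 then
    dyck_weight m' h.+1 + close_weight h * dyck_weight m' h.-1
  else (h == 0)%:R.

Lemma qnatS k : qnat k.+1 = qnat k + q ^+ k.
Proof. by rewrite /qnat big_nat_recr. Qed.

Lemma qnatSl k : qnat k.+1 = 1 + q * qnat k.
Proof.
rewrite /qnat big_nat_recl // expr0 big_distrr /=; congr (_ + _).
by apply: eq_bigr => i _; rewrite exprS.
Qed.

Lemma exp_qnat k : q ^+ k = 1 - (1 - q) * qnat k.
Proof.
elim: k => [|k IH]; first by rewrite /qnat big_geq // mulr0 subr0.
by rewrite qnatS exprS IH; ring.
Qed.

Lemma sum_powers m k : \sum_(m <= i < m + k) q ^+ i = q ^+ m * qnat k.
Proof.
rewrite -{1}[m]add0n [(m + k)%N]addnC big_addn addnK /qnat big_distrr /=.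
by apply: eq_bigr => i _; rewrite exprD mulrC.
Qed.

Lemma close_weight0 : close_weight 0 = 0.
Proof. by rewrite /close_weight big_geq. Qed.

Lemma close_weight1 : close_weight 1 = 1.
Proof. by rewrite /close_weight big_nat1 /edge_weight /= !mulr1. Qed.

Lemma close_weightSS h :
  close_weight h.+2 =
  q ^+ h.+1./2 * y +
  \sum_(0 <= c < h.+1)
     q ^+ c * x ^+ (c.*2 < h.+1)%N * y ^+ (h.+1 < c.*2)%N.
Proof.
rewrite /close_weight big_nat_recl // /edge_weight /= expr0 expr1 mulr1.
congr (_ + _); rewrite big_nat_rev /= add0n.
rewrite !big_nat; apply: eq_bigr => c /andP[_ lt_c].
have -> : (h.+1 - (h.+1 - c.+1).+1 = c)%N by lia.
by congr (_ * _ ^+ nat_of_bool _ * _ ^+ nat_of_bool _); lia.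
Qed.

(** Crossing numbers up to [k] give the nested edges. Crossed edges with an open point left of the
    opener have exponents [k+1] to [2k]; the leftmost opener, with its halved exponent [k],
    completes the [y]-part to [q^k [k+1]]. *)
Lemma close_weight_even k :
  close_weight k.+1.*2 = qnat k.+1 * (x + y * q ^+ k).
Proof.
rewrite doubleS close_weightSS (_ : (k.*2.+1)./2 = k); last by lia.
rewrite (@big_cat_nat _ _ _ k.+1) //=; last by lia.
rewrite [X in _ + (X + _)](_ : _ = qnat k.+1 * x); last first.
  rewrite /qnat big_distrl /= !big_nat; apply: eq_bigr => c /andP[_ ltc].
  rewrite (_ : (c.*2 < _)%N = true); last by lia.
  by rewrite (_ : (_ < c.*2)%N = false) ?mulr1 ?expr1 //; lia.
rewrite [X in _ + (_ + X)](_ : _ = q ^+ k.+1 * qnat k * y); last first.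
  rewrite -sum_powers (_ : (k.+1 + k = k.*2.+1)%N); last by lia.
  rewrite big_distrl /= !big_nat; apply: eq_bigr => c /andP[lec ltc].
  rewrite (_ : (c.*2 < _)%N = false); last by lia.
  by rewrite (_ : (_ < c.*2)%N = true) ?mulr1 ?expr1 //; lia.
by rewrite exprS {2}qnatSl; ring: (qnatSl k).
Qed.

(** As in the even case, except that the opener with crossing number [k] equal to its nesting number
    is neither nested nor crossed, whence the bare [q ^+ k]. *)
Lemma close_weight_odd k :
  close_weight k.*2.+1 = q ^+ k + qnat k * (x + y * q ^+ k).
Proof.
case: k => [|k]; first by rewrite close_weight1 /qnat big_geq // mul0r addr0.
rewrite doubleS close_weightSS (_ : (k.*2.+2)./2 = k.+1); last by lia.
rewrite (@big_cat_nat _ _ _ k.+1) //=; last by lia.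
rewrite (@big_cat_nat _ _ _ k.+2 k.+1) //=; last by lia.
rewrite big_nat1.
rewrite [X in _ + (X + _)](_ : _ = qnat k.+1 * x); last first.
  rewrite /qnat big_distrl /= !big_nat; apply: eq_bigr => c /andP[_ ltc].
  rewrite (_ : (c.*2 < _)%N = true); last by lia.
  by rewrite (_ : (_ < c.*2)%N = false) ?mulr1 ?expr1 //; lia.
rewrite [X in _ + (_ + (_ + X))](_ : _ = q ^+ k.+2 * qnat k * y); last first.
  rewrite -sum_powers (_ : (k.+2 + k = k.*2.+2)%N); last by lia.
  rewrite big_distrl /= !big_nat; apply: eq_bigr => c /andP[lec ltc].
  rewrite (_ : (c.*2 < _)%N = false); last by lia.
  by rewrite (_ : (_ < c.*2)%N = true) ?mulr1 ?expr1 //; lia.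
rewrite doubleS ltnn !expr0 !mulr1.
by rewrite [q ^+ k.+2]exprS; ring: (qnatSl k).
Qed.

End Weights.

(** * The column operator and its three-term recurrence *)

Section ColumnOperator.
Variables (R : idomainType) (q x y : R).

Local Notation w := (close_weight q x y).
Local Notation qnat := (qnat q).

(** The part of a column with [v] free rows still to fill and no Alpha or Gamma below. The lowest
    free box stays empty ([q *: 'X]), gets Beta ([1]), or gets Alpha or Gamma, and then the [v']
    free boxes above it stay empty with a factor 1 or q each. *)
Fixpoint open_column_poly (v : nat) : {poly R} :=
  if v is v'.+1 then
    (1 + q *: 'X) * open_column_poly v' + (x + y * q ^+ v') *: 'X^(v'.+1)
  else 1.

(** The diagonal box is never empty: Beta gives the first summand, Alpha or Gamma the second, where
    its own row joins the [r] free ones. *)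
Definition column_poly (r : nat) : {poly R} :=
  open_column_poly r + (x + y * q ^+ r) *: 'X^(r.+1).

Definition add_column (p : {poly R}) : {poly R} :=
  \sum_(i < size p) p`_i *: column_poly i.

Let D : {poly R} := 1 - (1 - q) *: 'X.

Let D_neq0 : D != 0.
Proof.
apply/eqP => /(congr1 (fun p : {poly R} => p`_0)) /eqP.
by rewrite coefB coefZ coefX coef1 coef0 mulr0 subr0 oner_eq0.
Qed.

(** Unrolling the recursion gives two geometric sums in [1 + qX], against [X] for Alpha and [qX] for
    Gamma. Their denominators are [D] and 1. *)
Lemma open_column_polyE r :
  D * open_column_poly r =
  (D * (1 + y *: 'X) + x *: 'X) * (1 + q *: 'X) ^+ r
  - (x%:P + (y * q ^+ r) *: D) * 'X^(r.+1).
Proof.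
rewrite /D; elim: r => [|r IH] /=.
  by rewrite !expr0 expr1 -!mul_polyC !polyCM polyCB; ring.
rewrite mulrDr mulrCA IH !exprS -!mul_polyC !polyCD !polyCM !polyCN.
ring.
Qed.

(** The diagonal term cancels the [y q^r] correction, so [r] survives only in powers of [1 + qX] and
    of [X]: a substitution and a multiplication. *)
Lemma column_polyE r :
  D * column_poly r =
  (D * (1 + y *: 'X) + x *: 'X) * (1 + q *: 'X) ^+ r
  - (x * (1 - q)) *: 'X^2 * 'X^r.
Proof.
rewrite /column_poly mulrDr open_column_polyE /D !exprS expr0 -!mul_polyC.
rewrite !polyCD !polyCM !polyCD !polyCN; ring.
Qed.

Lemma add_columnE p :
  D * add_column p =
  (D * (1 + y *: 'X) + x *: 'X) * (p \Po (1 + q *: 'X))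
  - (x * (1 - q)) *: 'X^2 * p.
Proof.
rewrite comp_polyE -[in X in _ - X](coefK p) poly_def !mulr_sumr -sumrB.
apply: eq_bigr => i _; rewrite -!scalerAr column_polyE scalerBr.
by congr (_ - _); rewrite -scalerAr.
Qed.

(** The defining sum is bounded by [size p], which is not additive; after multiplication by the
    nonzero [D] linearity is visible. *)
Lemma add_columnP a p r :
  add_column (a *: p + r) = a *: add_column p + add_column r.
Proof.
apply: (mulfI D_neq0); rewrite mulrDr -scalerAr !add_columnE comp_polyD comp_polyZ.
by rewrite -!mul_polyC; ring.
Qed.

Lemma add_column_Xn r : add_column 'X^r = column_poly r.
Proof.
by apply: (mulfI D_neq0); rewrite add_columnE column_polyE comp_Xn_poly.
Qed.

Lemma iter_add_columnP n a p r :
  iter n add_column (a *: p + r) =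
  a *: iter n add_column p + iter n add_column r.
Proof. by elim: n => //= n ->; rewrite add_columnP. Qed.

Lemma add_column_sum (I : Type) (s : seq I) (P : pred I) (F : I -> R) (r : I -> nat) :
  add_column (\sum_(i <- s | P i) F i *: 'X^(r i)) =
  \sum_(i <- s | P i) F i *: column_poly (r i).
Proof.
have add0 : add_column 0 = 0 by rewrite /add_column size_poly0 big_ord0.
elim/big_rec2: _ => // i p1 p2 _ <-.
by rewrite add_columnP add_column_Xn.
Qed.

Definition node_poly (k : nat) : {poly R} :=
  \prod_(0 <= i < k) ((x + y * q ^+ i) *: ('X - (qnat i.+1)%:P)).

Lemma node_polyS k :
  node_poly k.+1 = node_poly k * ((x + y * q ^+ k) *: ('X - (qnat k.+1)%:P)).
Proof. by rewrite /node_poly big_nat_recr. Qed.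

(** Since [[i+1] = 1 + q[i]], the substitution turns [X - [i+1]] into [q(X - [i])]: the roots move
    down one place and the first factor becomes [qX]. *)
Lemma node_poly_comp k :
  node_poly k.+1 \Po (1 + q *: 'X) =
  ((x + y * q ^+ k) * q ^+ k.+1) *: ('X * node_poly k).
Proof.
elim: k => [|k IH].
  rewrite /node_poly big_nat1 big_geq // comp_polyZ comp_polyB comp_polyX comp_polyC.
  by rewrite /qnat big_nat1 -!mul_polyC !expr0 !polyCM; ring.
rewrite node_polyS comp_polyM IH (node_polyS k) comp_polyZ comp_polyB comp_polyX.
rewrite comp_polyC (qnatSl q k.+1) -!mul_polyC !exprS !(polyCD, polyCM); ring.
Qed.

Lemma node_poly_at1 k : (node_poly k).[1] = (k == 0)%:R.
Proof.
case: k => [|k]; first by rewrite /node_poly big_geq // hornerE.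
rewrite /node_poly big_nat_recl // hornerM hornerZ hornerXsubC /qnat big_nat1.
by rewrite subrr mulr0 mul0r.
Qed.

Lemma add_column_node0 :
  add_column (node_poly 0) = (w 1 + w 2) *: node_poly 0 + node_poly 1.
Proof.
have -> : node_poly 0 = 'X^0 by rewrite /node_poly big_geq.
rewrite add_column_Xn /column_poly /= close_weight1 (close_weight_even _ _ _ 0).
rewrite /node_poly big_nat1 /qnat big_nat1 -!mul_polyC !expr0.
by rewrite !(polyCD, polyCM); ring.
Qed.

(* The Dyck weights of two consecutive down steps factor into the three-term
   recurrence: the node polynomials are the orthogonal polynomials of the
   matching path model, up to normalisation. *)
Lemma add_column_nodeS k :
  add_column (node_poly k.+1) =
  (w k.+1.*2.+1 + w k.+2.*2) *: node_poly k.+1 +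
  ((w k.+1.*2 * w k.+1.*2.+1) *: node_poly k + node_poly k.+2).
Proof.
apply: (mulfI D_neq0); rewrite add_columnE node_poly_comp !close_weight_even.
rewrite close_weight_odd !node_polyS (qnatSl q k.+1) (qnatSl q k) /D.
rewrite !exprS (exp_qnat q k) -!mul_polyC !(polyCD, polyCM, polyCN).
ring.
Qed.

(** Steps are taken in pairs, and a height change of 2, 0 or -2 matches the three terms of the
    recurrence. For the single last step only height 1 can reach 0, as only [node_poly 0] is nonzero
    at 1. *)
Lemma dyck_weight_add_column n k :
  dyck_weight q x y n.*2.+1 k.*2.+1 = (iter n add_column (node_poly k)).[1].
Proof.
elim: n k => [|n IH] k.
  rewrite /= node_poly_at1 double_eq0 add0r.
  by case: k => [|k]; rewrite ?mulr0 // close_weight1 mulr1.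
rewrite doubleS iterSr.
have -> m h : dyck_weight q x y m.+2 h.+1 = dyck_weight q x y m h.+3 +
    w h.+2 * dyck_weight q x y m h.+1 + w h.+1 * (dyck_weight q x y m h.+1 +
    w h * dyck_weight q x y m h.-1) by [].
rewrite -!doubleS !IH; case: k => [|k].
  rewrite add_column_node0 iter_add_columnP hornerD hornerZ close_weight0.
  by rewrite -!IH; ring.
rewrite add_column_nodeS !iter_add_columnP !hornerD !hornerZ -!IH.
rewrite [in LHS]doubleS /=; ring.
Qed.

End ColumnOperator.

(** * Matchings *)

Lemma sum_card (T : finType) (A : {set T}) (P : pred T) :
  (\sum_(e in A) P e)%N = #|[set e in A | P e]|.
Proof.
by rewrite -sum1dep_card big_mkcondr /=; apply: eq_bigr => e _; case: (P e).
Qed.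

(** The number of earlier elements of [P] takes the values 0, 1, 2, ... in turn. For openers this
    rank becomes the nesting number. *)
Lemma sum_rank (R : nmodType) (P : pred nat) (f : nat -> R) m :
  \sum_(0 <= i < m | P i) f (\sum_(0 <= u < i) P u)%N =
  \sum_(0 <= p < \sum_(0 <= u < m) P u) f p.
Proof.
elim: m => [|m IH]; first by rewrite !big_geq.
rewrite big_mkcond big_nat_recr //= -big_mkcond IH big_nat_recr //=.
by case: (P m); rewrite ?addr0 ?addn0 // addn1 big_nat_recr.
Qed.

Section Matchings.
Variables (R : comNzRingType) (q x y : R) (N : nat).
Implicit Types M : {set edge N}.

Definition partial_matching (m : nat) M : bool :=
  [forall e in M, (e.1 < e.2) && (e.2 < m)]%N &&
  [forall e in M, forall f in M, (e != f) ==> disjoint_edges e f].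

(* A point is open at time [j] when no edge closing before [j] uses it; at that
   time it is a potential opener of the edge closing at [j]. *)
Definition is_open (j : nat) M (u : nat) : bool :=
  (u < j)%N && [forall f in M, (f.2 < j)%N ==> (u != f.1) && (u != f.2)].

Definition num_open (m : nat) M : nat := \sum_(0 <= u < m) is_open m M u.

(** Crossings and nestings are predicted at closing time: an open point between the two ends, or
    left of the opener, will later start a crossing, respectively a nesting, edge. Edges added later
    do not change this value. *)
Definition open_weight M (e : edge N) : R :=
  edge_weight q x y (\sum_(e.1.+1 <= u < e.2) is_open e.2 M u)%N
                    (\sum_(0 <= u < e.1) is_open e.2 M u)%N.

Definition matching_weight M : R := \prod_(e in M) open_weight M e.

Lemma partial_matchingP m M :
  reflect ((forall e : edge N, e \in M -> (e.1 < e.2 < m)%N) /\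
           (forall e f : edge N, e \in M -> f \in M -> e != f -> disjoint_edges e f))
          (partial_matching m M).
Proof.
apply: (iffP andP) => [] [A B]; split.
- by move=> e eM; move/forall_inP/(_ e eM): A.
- by move=> e f eM fM; move/forall_inP/(_ e eM)/forall_inP/(_ f fM)/implyP: B.
- by apply/forall_inP.
- by apply/forall_inP => e eM; apply/forall_inP => f fM; apply/implyP; apply: B.
Qed.

Lemma is_openP j M u :
  reflect ((u < j)%N /\
     forall f : edge N, f \in M -> (f.2 < j)%N -> u <> f.1 /\ u <> f.2)
    (is_open j M u).
Proof.
apply: (iffP andP) => [] [A B]; split=> //.
  move=> f fM lt; move/forall_inP/(_ f fM)/implyP/(_ lt): B.
  by case/andP => /eqP ? /eqP.
apply/forall_inP => f fM; apply/implyP => lt.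
by have [/eqP -> /eqP ->] := B f fM lt.
Qed.

Lemma disjoint_edgesP (e f : edge N) :
  reflect [/\ e.1 <> f.1 :> nat, e.1 <> f.2 :> nat, e.2 <> f.1 :> nat
            & e.2 <> f.2 :> nat] (disjoint_edges e f).
Proof.
rewrite /disjoint_edges -!(inj_eq val_inj) /=.
by apply: (iffP and4P) => [] [/eqP ? /eqP ? /eqP ? /eqP ?].
Qed.

(** * Reading one more point of a matching *)

Section Step.
Variables (m : nat) (ltmN : (m < N)%N).
Let o : 'I_N := Ordinal ltmN.

Lemma partial_matching_noclose M :
  partial_matching m.+1 M && ~~ [exists i, (i, o) \in M] =
  partial_matching m M.
Proof.
apply/andP/partial_matchingP.
  move=> [/partial_matchingP[A B] /existsPn C]; split=> // e eM.
  have := A e eM; suff : e.2 <> m :> nat by lia.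
  move=> e2; have := C e.1; suff -> : (e.1, o) = e by rewrite eM.
  by case: e e2 {eM} => a b /= e2; congr pair; apply: val_inj.
move=> [A B]; split.
  by apply/partial_matchingP; split=> // e eM; have := A e eM; lia.
by apply/existsPn => i; apply/negP => /A /=; rewrite ltnn andbF.
Qed.

Lemma partial_matching_close M (i : 'I_N) : partial_matching m M -> is_open m M i ->
  partial_matching m.+1 ((i, o) |: M).
Proof.
move=> /partial_matchingP[A B] /is_openP[lt C].
apply/partial_matchingP; split.
  by move=> e /setU1P[-> /=|/A]; lia.
have D (f : edge N) : f \in M -> disjoint_edges (i, o) f /\ disjoint_edges f (i, o).
  move=> fM; have := A f fM; have := C f fM => C' A'.
  have {C'} [] : i <> f.1 :> nat /\ i <> f.2 :> nat by apply: C'; lia.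
  by move=> ? ?; split; apply/disjoint_edgesP; split=> /=; lia.
move=> e f /setU1P[->|eM] /setU1P[->|fM]; first by rewrite eqxx.
- by case: (D f fM).
- by case: (D e eM).
- exact: B.
Qed.

(** Point [m] either stays a potential opener or closes an edge from an open point; deleting that
    edge inverts adding it. *)
Lemma sum_partial_matchingS (G : {set edge N} -> R) :
  \sum_(M | partial_matching m.+1 M) G M =
  \sum_(M | partial_matching m M)
     (G M + \sum_(i | is_open m M (val i)) G ((i, o) |: M)).
Proof.
rewrite (bigID (fun M : {set edge N} => [exists i, (i, o) \in M])) /= addrC.
rewrite big_split /=; congr (_ + _).
  by apply: eq_bigl => M; rewrite partial_matching_noclose.
rewrite pair_big_dep /=.
pose add (p : {set edge N} * 'I_N) := (p.2, o) |: p.1.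
(* The default [o] is never reached: [del] is only applied to matchings with an edge closing at
   [o]. *)
pose del M := (M :\: [set e | e.2 == o], odflt o [pick i | (i, o) \in M]).
have delK M : partial_matching m M -> forall i, del (add (M, i)) = (M, i).
  move=> /partial_matchingP[A _] i; have notM i' : (i', o) \in M -> False.
    by move=> /A /=; rewrite ltnn andbF.
  congr pair.
    apply/setP => e; rewrite !inE; case: eqP => [e2|ne] /=; last first.
      by case: eqP ne => // -> /(_ erefl).
    by apply/esym/negP; case: e e2 => a b /= ->; apply: notM.
  case: pickP => [i'|/(_ i)]; last by rewrite setU11.
  by move=> /setU1P[[]|/notM].
rewrite (reindex_onto add del) /=.
  apply: eq_bigl => -[M i] /=; apply/idP/idP.
    case/andP => /andP[/partial_matchingP[A B] _] /eqP E.
    have {}E : M = add (M, i) :\: [set e | e.2 == o] by case: E.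
    have no (e : edge N) : e \in M -> e.2 != o by rewrite E !inE => /andP[].
    have sub (e : edge N) : e \in M -> e \in add (M, i) by apply: setU1r.
    have i_in : (i, o) \in add (M, i) by apply: setU11.
    have {}no (e : edge N) : e \in M -> (e.2 < m)%N.
      move=> eM; have := no e eM; have := A e (sub e eM).
      by rewrite -(inj_eq val_inj) /=; lia.
    apply/andP; split.
      apply/partial_matchingP; split=> [e eM|e f eM fM].
        by have := A e (sub e eM); have := no e eM; lia.
      by apply: B; apply: sub.
    apply/is_openP; split; first by have := A _ i_in; rewrite /=; lia.
    move=> f fM ltf; have : (i, o) != f.
      by apply/eqP => /(congr1 snd) ef; move: ltf; rewrite -ef /= ltnn.
    by move=> /(B _ _ i_in (sub f fM)) /disjoint_edgesP[].
  case/andP => pM oi; rewrite (delK _ pM) eqxx andbT.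
  rewrite (partial_matching_close pM oi) /=.
  by apply/existsP; exists i; apply: setU11.
move=> M /andP[/partial_matchingP[A B] /existsP[i0 i0M]].
rewrite /add /del /=; case: pickP => [i iM|/(_ i0)]; last by rewrite i0M.
apply/setP => e; rewrite !inE; case: (boolP (e == (i, o))) => [/eqP-> //|ne /=].
case: eqP => //= e2; apply/esym/negP => eM.
by have /disjoint_edgesP[_ _ _] := B _ _ eM iM ne; rewrite e2.
Qed.

Lemma is_openU1 j M (i : 'I_N) u : (j <= m)%N ->
  is_open j ((i, o) |: M) u = is_open j M u.
Proof.
move=> le; apply/is_openP/is_openP => [] [A B]; split=> // f.
  by move=> fM; apply: B; apply: setU1r.
by move=> /setU1P[-> /=|/B //]; lia.
Qed.

Lemma is_openS M u : partial_matching m M ->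
  is_open m.+1 M u = (u == m) || is_open m M u.
Proof.
move=> /partial_matchingP[A _]; apply/is_openP/orP.
  move=> [lt B]; case: (altP (u =P m)) => [|ne]; [by left|right].
  by apply/is_openP; split=> [|f fM ltf]; [lia|apply: B => //; lia].
case=> [/eqP->|/is_openP[lt B]]; split=> [|f fM _]; try lia.
  by have := A f fM; lia.
by apply: B => //; have := A f fM; lia.
Qed.

Lemma is_openS_close M (i : 'I_N) u : partial_matching m M ->
  is_open m.+1 ((i, o) |: M) u = (u != i) && is_open m M u.
Proof.
move=> /partial_matchingP[A _]; apply/is_openP/andP.
  move=> [lt B]; have [/= ui um] := B _ (setU11 (i, o) M) (ltnSn m).
  split; first exact/eqP.
  apply/is_openP; split=> [|f fM ltf]; first lia.
  by apply: B; [apply: setU1r|lia].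
case=> /eqP ui /is_openP[lt B]; split=> [|f /setU1P[-> /= _|fM _]]; rewrite /=; try lia.
by apply: B => //; have := A f fM; lia.
Qed.

Lemma num_openS M : partial_matching m M -> num_open m.+1 M = (num_open m M).+1.
Proof.
move=> pM; rewrite /num_open big_nat_recr //= is_openS // eqxx addn1; congr _.+1.
by apply: eq_big_nat => u /andP[_ lt]; rewrite is_openS // ltn_eqF.
Qed.

Lemma num_openS_close M (i : 'I_N) : partial_matching m M -> is_open m M i ->
  num_open m M = (num_open m.+1 ((i, o) |: M)).+1.
Proof.
move=> pM oi; rewrite /num_open big_nat_recr //= is_openS_close //.
have ltim : (i < m)%N by case/is_openP: oi.
rewrite [is_open m M m]/is_open ltnn andbF addn0 !big_mkord.
rewrite (bigD1 (Ordinal ltim)) //= oi add1n; congr _.+1.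
rewrite [RHS](bigD1 (Ordinal ltim)) //= is_openS_close // eqxx /= add0n.
apply: eq_bigr => u; rewrite is_openS_close // -(inj_eq val_inj) /=.
by move=> ->.
Qed.

Lemma matching_weight_close M (i : 'I_N) : partial_matching m M ->
  is_open m M i ->
  matching_weight ((i, o) |: M) =
  edge_weight q x y ((num_open m M).-1 - \sum_(0 <= u < i) is_open m M u)
    (\sum_(0 <= u < i) is_open m M u)%N * matching_weight M.
Proof.
move=> pM oi; case/partial_matchingP: (pM) => A _.
rewrite /matching_weight big_setU1 /=; last first.
  by apply/negP => /A /=; rewrite ltnn andbF.
have ltim : (i < m)%N by case/is_openP: oi.
congr (_ * _).
  rewrite /open_weight /=; congr (edge_weight _ _ _ _ _); last first.
    by apply: eq_bigr => u _; rewrite is_openU1.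
  rewrite /num_open [in RHS](@big_cat_nat _ _ _ i) //=; last exact: ltnW.
  rewrite [\sum_(i <= u < m) _]big_ltn // oi addnCA add1n /= addKn.
  by apply: eq_bigr => u _; rewrite is_openU1.
apply: eq_bigr => e eM; have le : (e.2 <= m)%N by have := A e eM; lia.
by rewrite /open_weight; congr (edge_weight _ _ _ _ _);
   apply: eq_bigr => u _; rewrite is_openU1.
Qed.

Lemma sum_close_weight M : partial_matching m M ->
  \sum_(i | is_open m M (val i)) matching_weight ((i, o) |: M) =
  close_weight q x y (num_open m M) * matching_weight M.
Proof.
move=> pM; set h := num_open m M.
pose f p := edge_weight q x y (h.-1 - p) p.
transitivity (\sum_(i < N | is_open m M i)
    f (\sum_(0 <= u < i) is_open m M u)%N * matching_weight M).
  by apply: eq_bigr => i oi; rewrite matching_weight_close.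
rewrite -big_distrl /=; congr (_ * _).
rewrite /close_weight -/(f _) -[LHS](big_mkord (is_open m M)
  (fun i => f (\sum_(0 <= u < i) is_open m M u)%N)).
rewrite -(sum_rank (is_open m M) f) [in RHS](big_nat_widen _ _ N) 1?ltnW //.
rewrite [RHS](eq_bigl (is_open m M)) // => u.
by rewrite andb_idr // => /is_openP[].
Qed.

End Step.

(** Invariant of the scan: after [m] points, with [t] steps to come, the number of open points is
    the height of the path. *)
Lemma sum_partial_matching m t : (m <= N)%N ->
  \sum_(M | partial_matching m M)
     matching_weight M * dyck_weight q x y t (num_open m M) =
  dyck_weight q x y (t + m) 0.
Proof.
elim: m t => [|m IH] t ltm.
  rewrite (bigD1 set0) /=; last first.
    by apply/partial_matchingP; split=> [e|e f]; rewrite inE.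
  rewrite big1 => [|M /andP[/partial_matchingP[A _]]]; last first.
    by case/set0Pn => e /A; rewrite ltn0 andbF.
  by rewrite /matching_weight big_set0 mul1r /num_open big_geq // addr0 addn0.
rewrite (sum_partial_matchingS ltm) addnS -addSn -IH 1?ltnW //.
apply: eq_bigr => M pM; rewrite num_openS //= mulrDr; congr (_ + _).
rewrite mulrA [_ * close_weight _ _ _ _]mulrC -(sum_close_weight ltm pM) big_distrl /=.
by apply: eq_bigr => i oi; rewrite [in RHS](num_openS_close ltm pM oi).
Qed.

End Matchings.

(** * Complete matchings and their statistics *)

Section PerfectMatchings.
Variable N : nat.
Implicit Types M : {set edge N}.

Lemma opener_inj M : partial_matching N M ->
  {in M &, injective (fst : edge N -> 'I_N)}.
Proof.
move=> /partial_matchingP[_ B] e f eM fM e1; apply/eqP/negPn/negP.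
by move=> /(B _ _ eM fM) /disjoint_edgesP[[]]; rewrite e1.
Qed.

Lemma num_open_card M : partial_matching N M ->
  (num_open N M + 2 * #|M| = N)%N.
Proof.
move=> pM; have inj1 := opener_inj pM; case/partial_matchingP: pM => A B.
have inj2 : {in M &, injective (snd : edge N -> 'I_N)}.
  move=> e f eM fM e2; apply/eqP/negPn/negP => /(B _ _ eM fM).
  by case/disjoint_edgesP => _ _ _ []; rewrite e2.
pose C : {set 'I_N} := [set e.1 | e in M] :|: [set e.2 | e in M].
have cardC : #|C| = (2 * #|M|)%N.
  rewrite cardsU disjoint_setI0 ?cards0 ?subn0; last first.
    rewrite -setI_eq0; apply/eqP/setP => u; rewrite !inE; apply/negP.
    case/andP=> /imsetP[e eM ->] /imsetP[f fM].
    case: (altP (e =P f)) => [<-|ne] ef.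
      by case/andP: (A e eM); rewrite ef ltnn.
    by have /disjoint_edgesP[_ []] := B _ _ eM fM ne; rewrite ef.
  by rewrite card_in_imset // card_in_imset // mul2n addnn.
rewrite -cardC; apply: etrans (card_ord N).
rewrite -(cardsC C) addnC; congr (_ + _)%N.
rewrite /num_open big_mkord -sum1_card [RHS]big_mkcond /=.
apply: eq_bigr => u _.
suff -> : is_open N M u = (u \in ~: C) by case: (u \in _).
rewrite !inE; apply/is_openP/norP.
  case=> _ D; split; apply/negP => /imsetP[e eM ue];
    case: (D e eM (ltn_ord _)); rewrite -ue => n1 n2;
    first [by case: n1|by case: n2].
case=> n1 n2; split=> // f fM _.
by split=> uf; [case/negP: n1|case/negP: n2]; apply/imsetP; exists f => //;
   apply: val_inj.
Qed.

(** As no point stays open at the end, a point open at time [j] is the opener of an edge closing at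
    [j] or later; the last hypothesis rules out [j] itself. Openers determine edges, so counting
    points counts edges. *)
Lemma open_sum_card M (a b j : nat) :
  partial_matching N M -> num_open N M = 0 -> (b <= j <= N)%N ->
  (forall e : edge N, e \in M -> e.2 = j :> nat -> ~~ (a <= e.1 < b)%N) ->
  (\sum_(a <= u < b) is_open j M u)%N =
  #|[set f in M | (a <= f.1 < b)%N && (j < f.2)%N]|.
Proof.
move=> pM none lebj Hj; have inj1 := opener_inj pM; case/partial_matchingP: (pM) => A B.
rewrite -(card_in_imset (f := fst : edge N -> 'I_N)); last first.
  by apply: sub_in2 inj1 => e; rewrite inE => /andP[].
transitivity (\sum_(u < N) ((a <= u < b) && is_open j M u)%N)%N.
  rewrite (big_nat_widen a b N); last by lia.
  rewrite (big_nat_widenl a 0 N) // big_mkcond big_mkord /=.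
  apply: eq_bigr => u _.
  by case: (a <= u)%N; case: (u < b)%N.
rewrite -sum1_card [RHS]big_mkcond /=; apply: eq_bigr => u _.
set S := imset _ _; suff -> : (a <= u < b)%N && is_open j M u = (u \in S).
  by case: (u \in S).
apply/andP/imsetP.
  case=> ab /is_openP[ltuj C].
  have : ~~ is_open N M u.
    apply/negP => o; move: none; rewrite /num_open big_mkord (bigD1 u) //= o.
    by rewrite add1n.
  rewrite /is_open ltn_ord /= => /forall_inPn[f fM].
  rewrite ltn_ord /= negb_and !negbK => uf; exists f; last first.
    case/orP: uf => /eqP uf; first exact: val_inj.
    by case: (C f fM); rewrite -?uf.
  have uf1 : u = f.1 :> nat.
    case/orP: uf => /eqP uf //.
    by case: (C f fM); rewrite -?uf.
  rewrite !inE fM -uf1 ab /=.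
  case: (ltngtP j f.2) => // [ltf|jf]; first by case: (C f fM ltf).
  by have := Hj f fM (esym jf); rewrite -uf1 ab.
case=> f; rewrite inE => /andP[fM /andP[ab lt]] ->; split=> //.
apply/is_openP; split=> [|e eM lte]; first lia.
have ne : e != f by apply/eqP => ef; move: lte lt; rewrite ef; lia.
by have /disjoint_edgesP[? ? ? ?] := B _ _ eM fM ne; split; apply/nesym.
Qed.

End PerfectMatchings.

Lemma perfect_matchingE n (M : {set edge (2 * n + 2)}) :
  is_perfect_matching M =
  partial_matching (2 * n + 2) M && (num_open (2 * n + 2) M == 0)%N.
Proof.
have -> : partial_matching (2 * n + 2) M =
    [forall e in M, (e.1 < e.2)%N] &&
    [forall e in M, forall f in M, (e != f) ==> disjoint_edges e f].
  congr (_ && _); apply: eq_forallb => e.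
  by rewrite (ltn_ord e.2) andbT.
rewrite /is_perfect_matching.
case: (boolP ([forall e in M, (e.1 < e.2)%N] && _)) => [pM|]; last by rewrite andbF.
have {}pM : partial_matching (2 * n + 2) M.
  case/andP: pM => pM1 pM2; rewrite /partial_matching pM2 andbT.
  apply/forall_inP => e /(forall_inP pM1) ->; exact: ltn_ord.
by rewrite andbT; have := num_open_card pM; lia.
Qed.

Lemma perfect_matching_weight (R : comNzRingType) (q x y : R) n
    (M : {set edge (2 * n + 2)}) : is_perfect_matching M ->
  matching_weight q x y M =
  q ^+ total_f_crossing M * x ^+ num_nested M * y ^+ num_crossed M.
Proof.
rewrite perfect_matchingE => /andP[pM /eqP none].
case/partial_matchingP: (pM) => A B.
rewrite /total_f_crossing /num_nested /num_crossed -!sum_card.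
rewrite -!prodrXr -!big_split /=; apply: eq_bigr => e eM.
have uniq_closer (f : edge (2 * n + 2)) : f \in M -> f.2 = e.2 :> nat -> f = e.
  move=> fM ef; apply/eqP/negPn/negP => /(B _ _ fM eM).
  by case/disjoint_edgesP.
have lte := A e eM; rewrite /open_weight.
rewrite !open_sum_card //; try lia; try by move=> f fM /(uniq_closer f fM) ->; lia.
have -> : #|[set f in M | (e.1 < f.1 < e.2)%N && (e.2 < f.2)%N]| = cross M e.
  by apply: eq_card => f; rewrite !inE -andbA.
have -> : #|[set f in M | (0 <= f.1 < e.1)%N && (e.2 < f.2)%N]| = nest M e.
  by apply: eq_card => f; rewrite !inE; case/andP: lte => lt12 _; rewrite lt12.
by [].
Qed.

(** * Tableaux *)

Lemma sum_option_label (V : nmodType) (F : option label -> V) :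
  \sum_v F v = F None + (F (Some Alpha) + (F (Some Beta) +
                (F (Some Gamma) + F (Some Delta)))).
Proof.
rewrite (bigD1 None) // (bigD1 (Some Alpha)) // (bigD1 (Some Beta)) //.
rewrite (bigD1 (Some Gamma)) // (bigD1 (Some Delta)) //= big1 ?addr0 //.
by case=> [[]|].
Qed.

Section Fillings.
Variable N : nat.
Implicit Types (T : filling N) (b c d : box N) (S : {set box N}).

Lemma box_inj b c : brow b = brow c -> bcol b = bcol c -> b = c.
Proof.
rewrite /brow /bcol => br bc; apply: val_inj.
by case: (val b) (val c) br bc => [b1 b2] [c1 c2] /= ? ?;
   congr pair; apply: val_inj.
Qed.

Lemma box_bound b : (brow b + bcol b < N)%N.
Proof. exact: valP b. Qed.

Lemma boxP i k : (i + k < N)%N -> exists b, brow b = i /\ bcol b = k.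
Proof.
move=> lt; have lti : (i < N)%N by lia. have ltk : (k < N)%N by lia.
by exists (exist _ (Ordinal lti, Ordinal ltk) lt).
Qed.

Definition supported S T : bool := [forall b, (T b != None) ==> (b \in S)].

Definition update T b (v : option label) : filling N :=
  [ffun c => if c == b then v else T c].

Lemma supportedP S T : reflect (forall b, b \notin S -> T b = None) (supported S T).
Proof.
apply: (iffP forallP) => H b.
  by move: (H b); case: (T b) => //= l /[swap] /negbTE ->.
by apply/implyP; apply: contraNT => /H ->.
Qed.

Lemma sum_supportedU1 (V : nmodType) S b (G : filling N -> V) : b \notin S ->
  \sum_(T | supported (b |: S) T) G T =
  \sum_(T | supported S T) \sum_v G (update T b v).
Proof.
move=> notS; rewrite pair_big_dep /=.
rewrite (reindex_onto (fun p : filling N * option label => update p.1 b p.2)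
  (fun T => (update T b None, T b))) /=; last first.
  by move=> T _; apply/ffunP => c; rewrite !ffunE; case: eqP => // ->.
apply: eq_bigl => -[T v] /=; rewrite andbT; apply/andP/supportedP.
  case=> /supportedP H /eqP[<- _] c cS; rewrite !ffunE; case: eqP => // /eqP ne.
  by have := H c; rewrite !inE negb_or ne cS ffunE (negbTE ne); apply.
move=> H; split.
  apply/supportedP => c; rewrite !inE negb_or ffunE => /andP[/negbTE-> ].
  exact: H.
apply/eqP; congr pair; last by rewrite ffunE eqxx.
by apply/ffunP => c; rewrite !ffunE; case: eqP => // ->; rewrite H.
Qed.

(** The tableau conditions localised at one box; they involve only boxes to its right and below, so
    they can be tested as the box is filled. *)
Definition box_ok T b : bool :=
  [&& diagonal b ==> (T b != None),
      [forall c, right_of b c && (T c \in [:: Some Beta; Some Delta])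
         ==> (T b == None)],
      [forall c, below b c && (T c \in [:: Some Alpha; Some Gamma])
         ==> (T b == None)]
    & T b != Some Delta].

Lemma all_box_ok T :
  [forall b, box_ok T b] = is_staircase_tableau T && delta_free T.
Proof.
apply/forallP/andP => [H|[/and3P[H1 H2 H3] H4] b].
  split; first (apply/and3P; split); apply/forallP => b;
    by have /and4P[] := H b.
apply/and4P; split; first exact: (forallP H1).
- exact: (forallP H2).
- exact: (forallP H3).
- exact: (forallP H4).
Qed.

Section Sees.
Variables (seen : rel (box N)) (T : filling N).

Definition sees b (l : label) : bool :=
  [exists c, [&& seen b c, T c == Some l
    & [forall d, seen b d && seen d c ==> (T d == None)]]].

Lemma exists_nearest (f : box N -> nat) b c0 :
  (forall d c, seen d c -> (f d < f c)%N) -> seen b c0 -> T c0 <> None ->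
  exists2 c, seen b c & exists2 l, T c = Some l & sees b l.
Proof.
move=> mono bc0 Tc0.
have Pc0 : seen b c0 && (T c0 != None) by rewrite bc0; apply/eqP.
case: (@arg_minnP _ c0 (fun c => seen b c && (T c != None)) f Pc0) => c.
case/andP => bc; case E: (T c) => [l|] // _ least.
exists c => //; exists l => //; apply/existsP; exists c; rewrite bc E eqxx /=.
apply/forallP => d; apply/implyP => /andP[bd dc].
apply: contraT => Td; have := least d; rewrite bd Td => /(_ isT).
by have := mono d c dc; lia.
Qed.

(** A label nearer than [c0] is excluded by hypothesis, and one beyond [c0] is hidden by it. *)
Lemma sees_blocked b c0 l0 l :
  (forall c, seen b c -> [\/ c = c0, seen c c0 | seen c0 c]) ->
  seen b c0 -> T c0 = Some l0 -> (forall c, seen c c0 -> T c = None) ->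
  sees b l -> l = l0.
Proof.
move=> total bc0 Tc0 blocked /existsP[c /and3P[bc /eqP Tc /forallP near]].
case: (total c bc) => [cc0|/blocked|c0c]; first by move: Tc; rewrite cc0 Tc0 => -[].
  by rewrite Tc.
by have := near c0; rewrite bc0 c0c Tc0.
Qed.

End Sees.

Lemma sees_rightE T b l : sees_right T b l = sees (@right_of N) T b l.
Proof. by []. Qed.

Lemma sees_belowE T b l : sees_below T b l = sees (@below N) T b l.
Proof. by []. Qed.

Lemma eq_sees (seen : rel (box N)) T T' b l :
  (forall c, seen b c -> T c = T' c) -> sees seen T b l = sees seen T' b l.
Proof.
move=> E; apply: eq_existsb => c; case: (boolP (seen b c)) => //= bc.
rewrite E //; congr (_ && _); apply: eq_forallb => d.
by case: (boolP (seen b d)) => //= bd; rewrite E.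
Qed.

Definition row_free T (i : nat) : bool :=
  [forall b, (brow b == i) ==> (T b != Some Beta)].

Definition col_has T (k : nat) (l : label) : bool :=
  [exists b, (bcol b == k) && (T b == Some l)].

Definition num_free T (i j : nat) : nat := \sum_(i <= r < j) row_free T r.

Lemma row_free_update T b v i : T b = None ->
  row_free (update T b v) i =
  row_free T i && ~~ ((i == brow b) && (v == Some Beta)).
Proof.
move=> Tb; apply/forallP/andP.
  move=> H; split.
    apply/forallP => c; have := H c; rewrite ffunE; case: (c =P b) => // -> _.
    by rewrite Tb implybT.
  by apply/negP => /andP[/eqP ib /eqP vB]; have := H b; rewrite ffunE -ib !eqxx vB.
case=> /forallP H v_i c; rewrite ffunE; case: (c =P b) => [->|_]; last exact: H.
by rewrite implybE -negb_and eq_sym.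
Qed.

Lemma col_has_update T b v l : T b = None ->
  col_has (update T b v) (bcol b) l = col_has T (bcol b) l || (v == Some l).
Proof.
move=> Tb; apply/existsP/orP.
  case=> c; rewrite ffunE; case: (c =P b) => [-> /andP[_ ->]|_ H]; first by right.
  by left; apply/existsP; exists c.
case=> [/existsP[c H]|vl]; last by exists b; rewrite ffunE !eqxx.
exists c; rewrite ffunE; case: (c =P b) => // cb.
by move: H; rewrite cb Tb andbF.
Qed.

Definition cells (k i : nat) : {set box N} :=
  [set b | (k < bcol b) || (bcol b == k) && (i <= brow b)]%N.

Lemma cellsS b : cells (bcol b) (brow b) = b |: cells (bcol b) (brow b).+1.
Proof.
apply/setP => c; rewrite !inE; case: (c =P b) => [->|ne].
  by rewrite !eqxx leqnn orbT.
have : ~ (brow c = brow b /\ bcol c = bcol b).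
  by case=> *; apply: ne; apply: box_inj.
by rewrite /=; lia.
Qed.

Lemma cells_notin b : b \notin cells (bcol b) (brow b).+1.
Proof. by rewrite !inE ltnn eqxx ltnn. Qed.

Lemma cells_full k : cells k (N - k) = cells k.+1 0.
Proof. by apply/setP => b; rewrite !inE; have := box_bound b; lia. Qed.

(* [b] is the next box to be filled: the columns are filled from right to left,
   each of them from bottom to top. *)
Section NextBox.
Variables (T : filling N) (b : box N).
Hypothesis suppT : supported (cells (bcol b) (brow b).+1) T.
Hypothesis okT : forall c, c \in cells (bcol b) (brow b).+1 -> box_ok T c.

Let Tb : T b = None.
Proof. by move/supportedP: suppT; apply; apply: cells_notin. Qed.

Let labelled c : T c <> None -> c \in cells (bcol b) (brow b).+1.
Proof.
by move=> Tc; apply: contraT => /(supportedP _ _ suppT).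
Qed.

Let no_delta c : T c <> Some Delta.
Proof.
move=> Tc; have /okT/and4P[_ _ _ /eqP] : c \in cells (bcol b) (brow b).+1.
  by apply: labelled; rewrite Tc.
by [].
Qed.

Let right_labelled c : T c <> None -> brow c = brow b -> right_of b c.
Proof. by move=> /labelled; rewrite !inE /right_of; lia. Qed.

Let below_labelled c : T c <> None -> bcol c = bcol b -> below b c.
Proof. by move=> /labelled; rewrite !inE /below; lia. Qed.

Let beta_blocks c c0 : T c0 = Some Beta -> right_of c c0 -> T c = None.
Proof.
move=> Tc0 cc0; case E: (T c) => [l|] //.
have /okT/and4P[_ /forallP/(_ c0) + _ _] : c \in cells (bcol b) (brow b).+1.
  by apply: labelled; rewrite E.
by rewrite cc0 Tc0 E.
Qed.

Let stop_blocks l c c0 : T c0 = Some l -> l \in [:: Alpha; Gamma] ->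
  below c c0 -> T c = None.
Proof.
move=> Tc0 ll cc0; case E: (T c) => [l'|] //.
have /okT/and4P[_ _ /forallP/(_ c0) + _] : c \in cells (bcol b) (brow b).+1.
  by apply: labelled; rewrite E.
by rewrite cc0 Tc0 E; case: (l) ll.
Qed.

Lemma row_freeE :
  row_free T (brow b) =
  ~~ [exists c, right_of b c && (T c \in [:: Some Beta; Some Delta])].
Proof.
rewrite negb_exists; apply: eq_forallb => c; rewrite !inE.
case E: (T c) => [[]|] //=; rewrite ?andbF ?implybT //.
  rewrite andbT implybF; congr negb; rewrite /right_of andb_idr // => /eqP rc.
  by have /andP[] : right_of b c by apply: right_labelled; rewrite ?E.
by case: (no_delta E).
Qed.

Lemma col_hasE :
  ~~ col_has T (bcol b) Alpha && ~~ col_has T (bcol b) Gamma =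
  ~~ [exists c, below b c && (T c \in [:: Some Alpha; Some Gamma])].
Proof.
rewrite -negb_or; congr negb; apply/orP/existsP.
  by case=> /existsP[c /andP[/eqP bc /eqP Tc]]; exists c;
     rewrite Tc inE ?eqxx ?andbT ?below_labelled // Tc.
case=> c /andP[/andP[bc _]]; rewrite !inE => /orP[] Tc; [left|right];
  by apply/existsP; exists c; rewrite bc.
Qed.

Lemma box_ok_update l : l != Delta ->
  box_ok (update T b (Some l)) b =
  [&& row_free T (brow b), ~~ col_has T (bcol b) Alpha
    & ~~ col_has T (bcol b) Gamma].
Proof.
move=> ll; rewrite col_hasE row_freeE /box_ok [update _ _ _ b]ffunE eqxx implybT.
have -> : (Some l != Some Delta) by apply: contra_neq ll => -[].
rewrite andbT andTb !negb_exists; congr (_ && _); apply: eq_forallb => c.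
  by rewrite implybF ffunE; case: (c =P b) => // ->; rewrite /right_of ltnn andbF.
by rewrite implybF ffunE; case: (c =P b) => // ->; rewrite /below ltnn andbF.
Qed.

Lemma update_None : update T b None = T.
Proof. by apply/ffunP => c; rewrite ffunE; case: eqP => // ->. Qed.

Lemma box_ok_None : box_ok T b = ~~ diagonal b.
Proof.
rewrite /box_ok Tb eqxx implybF /= andbT andb_idr // => _.
by apply/andP; split; apply/forallP => c; rewrite implybT.
Qed.

Lemma row_free_diagonal : diagonal b -> row_free T (brow b).
Proof.
move=> /eqP db; rewrite row_freeE; apply/existsP => -[c /andP[]].
by rewrite /right_of; have := box_bound c; lia.
Qed.

Lemma col_has_diagonal l : diagonal b -> col_has T (bcol b) l = false.
Proof.
move=> /eqP db; apply/existsP => -[c /andP[/eqP bc /eqP Tc]].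
have /labelled : T c <> None by rewrite Tc.
by rewrite inE; have := box_bound c; lia.
Qed.

(** Everything left of a Beta is empty, so a Beta in the row is the label seen; otherwise Alpha or
    Gamma is seen. Likewise an Alpha below is the label seen in the column, and without one it is
    Beta or Gamma. *)
Lemma assigned_q_None : ~~ diagonal b ->
  assigned_q T b = row_free T (brow b) && ~~ col_has T (bcol b) Alpha.
Proof.
move=> nd; have := box_bound b => bb.
have {}nd : (brow b + bcol b).+1 <> N by move/eqP: nd.
have diag_nonempty c : c \in cells (bcol b) (brow b).+1 ->
    (brow c + bcol c).+1 = N -> T c <> None.
  by move=> /okT/and4P[+ _ _ _] dc; rewrite /diagonal dc eqxx => /eqP.
rewrite /assigned_q Tb eqxx !sees_rightE !sees_belowE /=.
have -> : sees (@right_of N) T b Delta = false.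
  by apply/existsP => -[c /and3P[_ /eqP /no_delta]].
rewrite orFb; congr (_ && _).
  case: (boolP (row_free T (brow b))) => [free|].
    (* The diagonal box of the row is labelled, so some label is seen. *)
    have [|c0 [rc0 cc0]] := @boxP (brow b) (N - (brow b).+1); first lia.
    have [|||c bc [l Tc sl]] := @exists_nearest (@right_of N) T (@bcol N) b c0.
    - by move=> d c /andP[].
    - by rewrite /right_of rc0; lia.
    - by apply: diag_nonempty; [rewrite inE|]; lia.
    move/forallP/(_ c): free; case/andP: bc => -> _; rewrite Tc.
    case: l Tc sl => [_ ->||_ ->|/no_delta] //; by rewrite ?orbT.
  rewrite row_freeE negbK => /existsP[c0 /andP[bc0]]; rewrite !inE.
  case/orP => /eqP Tc0; last by case: (no_delta Tc0).
  have blocked l : sees (@right_of N) T b l -> l = Beta.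
    apply: (@sees_blocked (@right_of N) T b c0 _ l _ bc0 Tc0) => c;
      last exact: (beta_blocks Tc0).
    move=> /andP[rc _]; case/andP: bc0 => rc0 _; rewrite /right_of.
    case: (ltngtP (bcol c) (bcol c0)) => [lt|lt|eq].
    - by apply: Or32; rewrite (eqP rc) rc0.
    - by apply: Or33; rewrite (eqP rc) eq_sym rc0.
    - by apply: Or31; apply: box_inj => //; rewrite (eqP rc) (eqP rc0).
  by apply/norP; split; apply/negP => /blocked.
case: (boolP (col_has T (bcol b) Alpha)) => [/existsP[c0]|nA].
  case/andP => /eqP cc0 /eqP Tc0.
  have bc0 : below b c0 by apply: below_labelled; rewrite ?Tc0.
  have blocked l : sees (@below N) T b l -> l = Alpha.
    apply: (@sees_blocked (@below N) T b c0 _ l _ bc0 Tc0) => c;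
      last exact: (stop_blocks Tc0).
    move=> /andP[/eqP cc _]; rewrite /below cc cc0 eqxx /=.
    case: (ltngtP (brow c) (brow c0)) => [lt|lt|eq].
    - exact: Or32.
    - exact: Or33.
    - by apply: Or31; apply: box_inj => //; rewrite cc.
  by apply/negbTE/norP; split; apply/negP => /blocked.
have [|c0 [rc0 cc0]] := @boxP (N - (bcol b).+1) (bcol b); first lia.
have [|||c bc [l Tc sl]] := @exists_nearest (@below N) T (@brow N) b c0.
- by move=> d c /andP[].
- by rewrite /below cc0; lia.
- by apply: diag_nonempty; [rewrite inE|]; lia.
case: l Tc sl => [Tc _|_ ->|_ ->|/no_delta] //; rewrite ?orbT //.
case/negP: nA; apply/existsP; exists c; rewrite Tc eqxx andbT.
by case/andP: bc.
Qed.

End NextBox.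

End Fillings.

(** * Weights of tableaux, box by box and column by column *)

Section TableauWeights.
Variables (R : idomainType) (q x y : R) (N : nat).
Implicit Types (T : filling N) (b c d : box N) (S : {set box N}).

Definition box_weight T b : R :=
  (box_ok T b)%:R * q ^+ assigned_q T b
  * x ^+ (T b == Some Alpha) * y ^+ (T b == Some Gamma).

Definition filling_weight S T : R := \prod_(b in S) box_weight T b.

Lemma eq_box_weight T T' b :
  (forall c, [\/ c = b, right_of b c | below b c] -> T c = T' c) ->
  box_weight T b = box_weight T' b.
Proof.
move=> E; have Eb : T b = T' b by apply: E; apply: Or31.
have Er c : right_of b c -> T c = T' c by move=> ?; apply: E; apply: Or32.
have Ed c : below b c -> T c = T' c by move=> ?; apply: E; apply: Or33.
have ok : box_ok T b = box_ok T' b.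
  rewrite /box_ok Eb; congr [&& _, _, _ & _]; apply: eq_forallb => c.
    by case: (boolP (right_of b c)) => //= /Er ->.
  by case: (boolP (below b c)) => //= /Ed ->.
have aq : assigned_q T b = assigned_q T' b.
  rewrite /assigned_q Eb !sees_rightE !sees_belowE.
  by rewrite !(eq_sees (seen := @right_of N) _ Er) !(eq_sees (seen := @below N) _ Ed).
by rewrite /box_weight ok aq Eb.
Qed.

(** The new box is neither to the right of nor below any box filled earlier, so the earlier weights
    do not change. *)
Lemma filling_weight_update T b v :
  filling_weight (cells N (bcol b) (brow b)) (update T b v) =
  filling_weight (cells N (bcol b) (brow b).+1) T * box_weight (update T b v) b.
Proof.
rewrite cellsS /filling_weight big_setU1 ?cells_notin //= mulrC; congr (_ * _).
apply: eq_bigr => c; rewrite inE => cC; apply: eq_box_weight => d H.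
rewrite ffunE; case: eqP => // db; move: H cC; rewrite db.
by rewrite /right_of /below => -[->|/andP[/eqP-> H]|/andP[/eqP-> H]]; lia.
Qed.

Lemma filling_weight_ok S T : filling_weight S T != 0 ->
  forall b, b \in S -> box_ok T b.
Proof.
move=> W b bS; apply: contra_neqT W => nok.
by rewrite /filling_weight (bigD1 b) //= /box_weight (negbTE nok) !mul0r.
Qed.

Lemma filling_weight_setT T :
  filling_weight setT T =
  if is_staircase_tableau T && delta_free T then
    q ^+ num_q T * x ^+ num_label T Alpha * y ^+ num_label T Gamma
  else 0.
Proof.
rewrite -all_box_ok; case: ifPn => [/forallP ok|/forallPn[b nok]].
  have card (P : pred (box N)) : #|[set b | P b]| = (\sum_(b : box N) P b)%N.
    by rewrite -sum1dep_card big_mkcond; apply: eq_bigr => b _; case: (P b).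
  rewrite /num_q /num_label !card -!prodrXr -!big_split /=.
  rewrite /filling_weight (eq_bigl xpredT) => [|b]; last by rewrite inE.
  by apply: eq_bigr => b _; rewrite /box_weight ok mul1r.
by rewrite /filling_weight (bigD1 b) ?inE //= /box_weight (negbTE nok) !mul0r.
Qed.

(* The expected contribution of the rest of column [k], given its boxes in rows
   [>= i]. A free row stays free unless it receives a Beta; above an Alpha or
   Gamma nothing more is written, and the remaining free rows contribute
   a factor 1 or q each. *)
Definition potential (k i : nat) T : {poly R} :=
  let u := num_free T i (N - k) in
  let v := num_free T 0 i in
  if col_has T k Alpha then 'X^(u + v)
  else if col_has T k Gamma then q ^+ v *: 'X^(u + v)
  else 'X^u * open_column_poly q x y v.

Section NextBoxWeight.
Variables (T : filling N) (b : box N).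
Let k := bcol b.
Let i := brow b.
Hypothesis suppT : supported (cells N k i.+1) T.
Hypothesis okT : forall c, c \in cells N k i.+1 -> box_ok T c.

Let free := row_free T i.
Let hA := col_has T k Alpha.
Let hG := col_has T k Gamma.

Let Tb : T b = None.
Proof. by move/supportedP: suppT; apply; apply: cells_notin. Qed.

Lemma box_weight_None :
  box_weight (update T b None) b =
  if diagonal b then 0 else q ^+ (free && ~~ hA).
Proof.
rewrite update_None // /box_weight box_ok_None // Tb !mulr1.
by case: (boolP (diagonal b)) => nd; rewrite ?mul0r // mul1r assigned_q_None.
Qed.

Lemma box_weight_Some l : l != Delta ->
  box_weight (update T b (Some l)) b =
  [&& free, ~~ hA & ~~ hG]%:R * x ^+ (l == Alpha) * y ^+ (l == Gamma).
Proof.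
move=> ll; rewrite /box_weight box_ok_update // /assigned_q ffunE eqxx mulr1.
by case: l ll.
Qed.

Lemma box_weight_Delta : box_weight (update T b (Some Delta)) b = 0.
Proof.
by rewrite /box_weight /box_ok ffunE !eqxx !andbF !mul0r.
Qed.

Lemma num_free_update_above v :
  num_free (update T b v) 0 i = num_free T 0 i.
Proof.
apply: eq_big_nat => r /andP[_ lt].
by rewrite row_free_update // (ltn_eqF lt) andbT.
Qed.

Lemma num_free_update_below v :
  num_free (update T b v) i (N - k) =
  ((free && (v != Some Beta)) + num_free T i.+1 (N - k))%N.
Proof.
have lt : (i < N - k)%N by have := box_bound b; rewrite -/k -/i; lia.
rewrite /num_free big_ltn // row_free_update // eqxx; congr (_ + _)%N.
apply: eq_big_nat => r /andP[ltr _].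
by rewrite row_free_update // (gtn_eqF ltr) andbT.
Qed.

Lemma potential_update v :
  potential k i (update T b v) =
  let u := ((free && (v != Some Beta)) + num_free T i.+1 (N - k))%N in
  let v' := num_free T 0 i in
  if hA || (v == Some Alpha) then 'X^(u + v')
  else if hG || (v == Some Gamma) then q ^+ v' *: 'X^(u + v')
  else 'X^u * open_column_poly q x y v'.
Proof.
by rewrite /potential num_free_update_above num_free_update_below !col_has_update.
Qed.

(** In a row with a Beta, or above an Alpha or Gamma, only the empty box has nonzero weight. In the
    remaining case the four choices are the recursion of [open_column_poly]. *)
Lemma potential_step : ~~ diagonal b ->
  \sum_v box_weight (update T b v) b *: potential k i (update T b v) =
  potential k i.+1 T.
Proof.
move=> nd; rewrite sum_option_label box_weight_None (negbTE nd) box_weight_Delta.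
rewrite !box_weight_Some // scale0r addr0 !potential_update /potential /=.
have -> : num_free T 0 i.+1 = (num_free T 0 i + free)%N.
  by rewrite /num_free big_nat_recr.
rewrite -/hA -/hG; move: (num_free _ i.+1 _) (num_free _ _ i) => u v.
case: free; case: hA; case: hG;
  rewrite /= ?add0n ?mul0r ?scale0r ?addr0 ?expr0 ?scale1r //.
- by rewrite addn1 addSn addnS.
- by rewrite addn1 addSn addnS.
- by rewrite addn1 addSn addnS scalerA expr1 [q ^+ v.+1]exprS.
- rewrite addn1 /= !exprS !expr0 !exprD -!mul_polyC !(polyCD, polyCM, polyC1).
  ring.
- by rewrite addn0.
- by rewrite addn0.
- by rewrite !addn0.
- by rewrite !addn0.
Qed.

Lemma potential_diagonal : diagonal b ->
  \sum_v box_weight (update T b v) b *: potential k i (update T b v) =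
  column_poly q x y (num_free T 0 i).
Proof.
move=> db; rewrite sum_option_label box_weight_None db box_weight_Delta.
rewrite !box_weight_Some // !scale0r addr0 !potential_update /=.
have -> : free by apply: row_free_diagonal.
have -> : hA = false by apply: col_has_diagonal.
have -> : hG = false by apply: col_has_diagonal.
have -> : num_free T i.+1 (N - k) = 0%N.
  by rewrite /num_free big_geq //; move/eqP: db; rewrite -/k -/i; lia.
move: (num_free _ _ i) => v.
rewrite /column_poly /= !exprS !expr0 -!mul_polyC.
rewrite !(polyCD, polyCM, polyC1); ring.
Qed.

End NextBoxWeight.

Lemma sum_next_box (b : box N) (F G : filling N -> {poly R}) :
  let S := cells N (bcol b) (brow b).+1 in
  (forall T, supported S T -> (forall c, c \in S -> box_ok T c) ->
     \sum_v box_weight (update T b v) b *: F (update T b v) = G T) ->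
  \sum_(T | supported (cells N (bcol b) (brow b)) T)
     filling_weight (cells N (bcol b) (brow b)) T *: F T =
  \sum_(T | supported S T) filling_weight S T *: G T.
Proof.
move=> S H; rewrite {1}cellsS sum_supportedU1 ?cells_notin //.
apply: eq_bigr => T supT.
under eq_bigr => v _ do rewrite filling_weight_update -scalerA.
(* Fillings of weight 0 drop out; all others satisfy [box_ok] on [S]. *)
rewrite -scaler_sumr -/S; have [->|W] := eqVneq (filling_weight S T) 0.
  by rewrite !scale0r.
by rewrite H //; apply: filling_weight_ok.
Qed.

(** Generating polynomial of the columns from [k] on, ['X] marking the rows still free for the
    column to their left. *)
Definition tableau_poly (k : nat) : {poly R} :=
  \sum_(T | supported (cells N k 0) T)
     filling_weight (cells N k 0) T *: 'X^(num_free T 0 (N - k)).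

Lemma tableau_polyN : tableau_poly N = 1.
Proof.
have -> : tableau_poly N = \sum_(T | supported (cells N N 0) T) 1.
  apply: eq_bigr => T _; rewrite subnn /num_free big_geq // expr0.
  rewrite /filling_weight big1 ?scale1r // => b; rewrite inE.
  by have := box_bound b; lia.
rewrite (big_pred1 [ffun=> None]) // => T; apply/supportedP/eqP => [H|-> b _].
  by apply/ffunP => b; rewrite ffunE H // inE; have := box_bound b; lia.
by rewrite ffunE.
Qed.

Lemma tableau_polyS k : (k < N)%N ->
  tableau_poly k = add_column q x y (tableau_poly k.+1).
Proof.
move=> ltk.
pose P i := \sum_(T | supported (cells N k i) T)
  filling_weight (cells N k i) T *: potential k i T.
have P0 : tableau_poly k = P 0%N.
  apply: eq_bigr => T _; congr (_ *: _).
  by rewrite /potential /= [num_free T 0 0]/num_free big_geq // addn0 expr0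
     scale1r mulr1 !if_same.
have PS i : ((i + k).+1 < N)%N -> P i = P i.+1.
  move=> lt; have [|b [rb cb]] := @boxP N i k; first lia.
  rewrite /P -rb -cb; apply: (sum_next_box (b := b)) => T supT okT.
  apply: potential_step => //; rewrite /diagonal rb cb; lia.
have {}PS i : (i + k < N)%N -> P 0%N = P i.
  by elim: i => // i IH lt; rewrite -PS ?IH //; lia.
(* The diagonal box, where each column starts and where [potential_diagonal] replaces
   [potential_step]. *)
have [|b [rb cb]] := @boxP N (N - k.+1) k; first lia.
rewrite P0 (PS (N - k.+1)%N); last lia.
rewrite /P -{1 2 3}rb -{1 2 3}cb.
rewrite (sum_next_box (G := fun T => column_poly q x y (num_free T 0 (brow b)))).
  rewrite rb cb subnSK // cells_full.
  by rewrite /tableau_poly add_column_sum.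
move=> T supT okT; apply: potential_diagonal => //.
by rewrite /diagonal rb cb; lia.
Qed.

Lemma sum_filling_weight :
  \sum_T filling_weight setT T = dyck_weight q x y (2 * N + 2) 0.
Proof.
have E : tableau_poly 0 = iter N (add_column q x y) 1.
  have H k : (k <= N)%N -> tableau_poly (N - k) = iter k (add_column q x y) 1.
    elim: k => [|k IH] lt; first by rewrite subn0 tableau_polyN.
    by rewrite tableau_polyS ?subnSK ?IH //; lia.
  by rewrite -H // subnn.
have cellsT : cells N 0 0 = setT.
  by apply/setP => b; rewrite !inE; lia.
(* The first step is forced upwards, leaving an odd length from height 1. *)
have -> : dyck_weight q x y (2 * N + 2) 0 = dyck_weight q x y N.*2.+1 0.*2.+1.
  by rewrite mul2n addn2 /= close_weight0 mul0r addr0.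
rewrite dyck_weight_add_column (_ : node_poly _ _ _ 0 = 1); last first.
  by rewrite /node_poly big_geq.
rewrite -E /tableau_poly cellsT horner_sum [RHS](eq_bigl xpredT) => [|T]; last first.
  by apply/supportedP => b; rewrite inE.
by apply: eq_bigr => T _; rewrite hornerZ hornerXn expr1n mulr1.
Qed.

End TableauWeights.

(** * From generating polynomials to a bijection *)

Section Equidistribution.

Section Transport.
Variables (A B : finType) (S : eqType) (sA : A -> S) (sB : B -> S) (b0 : B).

Definition transport (a : A) : B :=
  nth b0 (enum [pred b | sB b == sA a]) (index a (enum [pred a' | sA a' == sA a])).

Hypothesis eq_fibers :
  forall s, #|[pred a | sA a == s]| = #|[pred b | sB b == s]|.

Lemma index_fiber a :
  (index a (enum [pred a' | sA a' == sA a])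
   < size (enum [pred b | sB b == sA a]))%N.
Proof. by rewrite -cardE -eq_fibers cardE index_mem mem_enum inE. Qed.

Lemma transport_stat a : sB (transport a) = sA a.
Proof.
by have := mem_nth b0 (index_fiber a); rewrite mem_enum inE => /eqP.
Qed.

End Transport.

Lemma transportK (A B : finType) (S : eqType) (sA : A -> S) (sB : B -> S) a0 b0 :
  (forall s, #|[pred a | sA a == s]| = #|[pred b | sB b == s]|) ->
  cancel (transport sA sB b0) (transport sB sA a0).
Proof.
move=> eq_fibers a; rewrite {1}/transport transport_stat //.
rewrite {1}/transport index_uniq ?enum_uniq ?index_fiber //.
by rewrite nth_index // mem_enum inE.
Qed.

Lemma eq_fibers_bijection (A B : finType) (S : eqType) (sA : A -> S) (sB : B -> S) :
  (forall s, #|[pred a | sA a == s]| = #|[pred b | sB b == s]|) ->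
  exists f : A -> B, bijective f /\ forall a, sB (f a) = sA a.
Proof.
(* [transport] needs a default element, so an empty [A] is treated apart; all fibres of [B] are then
   empty too. *)
move=> eq_fibers; case: (pickP (pred_of_argType A)) => [a0 _|A0]; last first.
  have notA (a : A) : False by have := A0 a.
  have notB (b : B) : False.
    have := eq_fibers (sB b); rewrite eq_card0 => [|a]; last by case: (notA a).
    by move/esym/card0_eq/(_ b); rewrite inE eqxx.
  exists (fun a => False_rect B (notA a)); split=> [|a]; last by case: (notA a).
  exists (fun b => False_rect A (notB b)) => [a|b]; last by case: (notB b).
  by case: (notA a).
have [b0 _] : exists b : B, sB b == sA a0.
  apply/existsP; rewrite -[[exists _, _]]negbK; apply/negP => /existsPn none.
  have := eq_fibers (sA a0).
  rewrite [RHS]eq_card0 => [/card0_eq/(_ a0)|b]; first by rewrite inE eqxx.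
  by rewrite inE (negbTE (none b)).
exists (transport sA sB b0); split; last exact: transport_stat.
by exists (transport sB sA a0); apply: transportK => // s; rewrite eq_fibers.
Qed.

Local Notation R3 := {poly {poly {poly int}}}.

(** The three variables sit at the three levels of a nested polynomial ring, so iterated
    coefficients isolate one triple of exponents. *)
Definition monomial (s : nat * nat * nat) : R3 :=
  'X ^+ s.1.1 * 'X%:P ^+ s.1.2 * 'X%:P%:P ^+ s.2.

Lemma coef_monomial s t :
  (monomial s)`_t.1.1`_t.1.2`_t.2 = (s == t)%:R.
Proof.
case: s t => [[a b] c] [[i j] k]; rewrite /monomial /= -!rmorphXn /=.
rewrite !coefMC coefXn !xpair_eqE (eq_sym a) (eq_sym b) (eq_sym c).
case: (i == a); last by rewrite mul0r coef0 mul0r coef0.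
rewrite mul1r coefXn; case: (j == b); last by rewrite mul0r coef0.
by rewrite mul1r coefXn.
Qed.

Lemma eq_monomial_bijection (A B : finType) (PA : pred A) (PB : pred B)
    (sA : A -> nat * nat * nat) (sB : B -> nat * nat * nat) :
  \sum_(a | PA a) monomial (sA a) = \sum_(b | PB b) monomial (sB b) ->
  exists f : {a | PA a} -> {b | PB b},
    bijective f /\ forall a, sB (val (f a)) = sA (val a).
Proof.
move=> E.
apply: (@eq_fibers_bijection {a | PA a} {b | PB b} _
  (fun a => sA (val a)) (fun b => sB (val b))).
have count (C : finType) (P : pred C) (sC : C -> nat * nat * nat) t :
    (\sum_(c | P c) monomial (sC c))`_t.1.1`_t.1.2`_t.2 =
    #|[pred c : {c | P c} | sC (val c) == t]|%:R.
  have -> : \sum_(c | P c) monomial (sC c) =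
            \sum_(c : {c | P c}) monomial (sC (val c)) by exact: (big_sub P).
  rewrite !coef_sum -sum1_card natr_sum [RHS]big_mkcond /=.
  by apply: eq_bigr => c _; rewrite coef_monomial inE; case: (_ == _).
(* Naturals embed in [int], so equal coefficients give equal fibre sizes. *)
move=> t; apply/eqP; rewrite -(Num.Theory.eqr_nat int).
by rewrite -!count E.
Qed.

End Equidistribution.

Theorem theorem4p15 (n : nat) :
  exists f : delta_free_tableau n -> perfect_matching n,
    bijective f /\
    forall (T : delta_free_tableau n) (j k l : nat),
      num_q (val T) = j ->
      num_label (val T) Alpha = k ->
      num_label (val T) Gamma = l ->
      [/\ total_f_crossing (val (f T)) = j,
          num_nested (val (f T)) = k
        & num_crossed (val (f T)) = l].
Proof.
pose sT (T : filling n) := (num_q T, num_label T Alpha, num_label T Gamma).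
pose sM (M : {set edge (2 * n + 2)}) :=
  (total_f_crossing M, num_nested M, num_crossed M).
have [|f [bij_f statE]] := @eq_monomial_bijection _ _
    (fun T => is_staircase_tableau T && delta_free T)
    (@is_perfect_matching n) sT sM; last first.
  exists f; split=> // T j k l <- <- <-.
  by case: (statE T) => -> -> ->.
pose q : {poly {poly {poly int}}} := 'X.
pose x : {poly {poly {poly int}}} := 'X%:P.
pose y : {poly {poly {poly int}}} := 'X%:P%:P.
transitivity (dyck_weight q x y (2 * n + 2) 0).
  rewrite -sum_filling_weight big_mkcond /=.
  by apply: eq_bigr => T _; rewrite filling_weight_setT.
(* With no step left, the Dyck factor is 1 on matchings without open points and 0 on the others. *)
rewrite -[LHS](sum_partial_matching q x y 0 (leqnn _)).
rewrite [RHS](eq_bigl _ _ (@perfect_matchingE n)) [RHS]big_mkcondr /=.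
apply: eq_bigr => M pM; case: eqP => [none|_]; last by rewrite mulr0.
rewrite mulr1 perfect_matching_weight // perfect_matchingE.
by rewrite none eqxx andbT.
Qed.
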